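(* Let $N>1$ be an integer and let $B_1(0)\subset\mathbb{R}^N$ be the open unit ball. Assume: (i) $f\colon[0,\infty)\to\mathbb{R}$ is continuous and nondecreasing, $f(0)<0$, and $f$ has exactly one zero $u_0>0$. (ii) There exist $p>1$ and $\alpha\in(p-1,p^* )$ such that $\lim_{s\to\infty} \frac{f(s)}{s^{\alpha}}>0$, where $p^*=\frac{Np}{N-p}$ if $N>p$ and $p^*=\infty$ if $p\geq N$. (iii) $\phi\colon\mathbb{R}\to[0,\infty)$ is continuous, differentiable in $\mathbb{R}\setminus\{0\}$, even, and increasing in $(0,\infty)$; and, with $\varphi(s):=\phi(s)s$ for $s\in\mathbb{R}$ and the same $p$ as in (ii), there exist positive constants $\hat c_1,\hat c_2$ such that $\hat c_2 r^{p-1}\leq\varphi(r)\leq\hat c_1 r^{p-1}$ for all $r\geq 0$. Then there exists $\lambda_0>0$ such that for every $\lambda>\lambda_0$ the problem $$-\operatorname{div}\bigl(\phi(|\nabla u|)\nabla u\bigr)=\lambda f(u)\ \text{ in } B_1(0),\qquad u=0\ \text{ on }\partial B_1(0),$$ has no positive radially symmetric solution.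
   Context: Radially symmetric solutions of the problem are understood, writing $u=u(r)$ with $r=|x|$, as solutions of the radial problem $$\bigl(r^{N-1}\varphi(u')\bigr)'=-\lambda r^{N-1}f(u)\ \ (0<r<1),\qquad u'(0)=0,\qquad u(1)=0,$$ where $'$ denotes the derivative with respect to $r$. A solution of the radial problem is a function $u\in C^1([0,1])$ with $\varphi(u')\in C^1((0,1))$ that satisfies the differential equation pointwise in $(0,1)$ together with $u'(0)=0$ and $u(1)=0$. A solution is positive if $u(r)>0$ for all $r\in[0,1)$. *)

(* Defs.v *)
From HB Require Import structures.
From mathcomp Require Import all_boot all_order all_algebra.
From mathcomp Require Import all_classical all_reals all_analysis.

Set Implicit Arguments.
Unset Strict Implicit.
Unset Printing Implicit Defensive.
Import Order.TTheory GRing.Theory Num.Theory.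
Import numFieldNormedType.Exports.
Local Open Scope classical_set_scope.
Local Open Scope ring_scope.

Definition critical_exponent (R : realType) (N : nat) (p : R) : \bar R :=
  if p < N%:R then ((N%:R * p) / (N%:R - p))%:E else +oo%E.

Definition varphi (R : realType) (phi : R -> R) (s : R) : R := phi s * s.

(* The difference quotient is only taken along A, so that at an endpoint of an
   interval A this is the one-sided derivative. *)
Definition has_derivative_within (R : realType) (A : set R) (u : R -> R)
    (r d : R) : Prop :=
  (u s - u r) / (s - r) @[s --> within A r^'] --> d.

(* The function du is the derivative of u on [0, 1], one-sided at 0 and 1.
   The values of u and du outside [0, 1] are irrelevant. *)
Definition radial_solution (R : realType) (N : nat) (phi f : R -> R)
    (lambda : R) (u : R -> R) : Prop :=
  exists du : R -> R,
    [/\ (forall r, r \in `[0, 1] -> has_derivative_within `[0, 1] u r (du r)) /\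
          {within `[0, 1], continuous du},
        (forall r, r \in `]0, 1[ -> derivable (varphi phi \o du) r 1) /\
          {within `]0, 1[, continuous (derive1 (varphi phi \o du))},
        forall r, r \in `]0, 1[ ->
          derive1 (fun s : R => s ^+ N.-1 * varphi phi (du s)) r =
            - (lambda * r ^+ N.-1 * f (u r)),
        du 0 = 0
      & u 1 = 0].

Definition positive_radial_solution (R : realType) (N : nat) (phi f : R -> R)
    (lambda : R) (u : R -> R) : Prop :=
  radial_solution N phi f lambda u /\ (forall r, r \in `[0, 1[ -> 0 < u r).

(* Main.v *)
(* Along a solution [u] the energy [lambda F(u) + H(u')], where [F' = f] and
   [H(s) = \int_0^s t d(varphi t)], is nonincreasing and is nonnegative at
   [r = 1], hence on all of [0, 1].  Since [F < 0] on (0, u0], critical points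
   of [u] lie above the level [u0], and [u] is nonincreasing.

   Fix [b > u0] with [F b < 0].  As [F] is convex, [F s <= s * F b / b] on
   [0, b], so wherever [u <= b] the energy bound gives [|u'| >= A * u^(1/p)]
   with [A] of order [lambda^(1/p)]. As [1/p < 1], this is incompatible with
   [u <= b] on [1/2, 3/4] for [lambda] large. If instead [u >= b] on [0,
   1/2], integrating the equation over [0, r] gives [varphi(|u'|) >= lambda
   * f(u) * r / N], hence [|u'| >= B * u^(alpha/(p-1))] on [1/4, 1/2] with
   [B] of order [lambda^(1/(p-1))]. As [alpha/(p-1) > 1], this is impossible
   for [lambda] large. *)

Require Import Defs.
From HB Require Import structures.
From mathcomp Require Import all_boot all_order all_algebra.
From mathcomp Require Import all_classical all_reals all_analysis.
From mathcomp Require Import ring lra.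

Set Implicit Arguments.
Unset Strict Implicit.
Unset Printing Implicit Defensive.
Import Order.TTheory GRing.Theory Num.Theory.
Import numFieldNormedType.Exports.
Local Open Scope classical_set_scope.
Local Open Scope ring_scope.

(** * Calculus: antiderivatives, derivatives within a set, chain rule for the energy *)

Lemma continuous_antiderivative (R : realType) (g : R -> R) (a : R) :
  continuous g -> exists G : R -> R, forall x, a < x -> is_derive x 1 G (g x).
Proof.
move=> cg.
exists (fun x => (\int[lebesgue_measure]_(t in [set` `[a, x]]) g t)%R) => x ax.
(* The interval runs to [x + 1] so that [x] is interior and the derivative obtained is two-sided. *)
have gint : lebesgue_measure.-integrable `[a, x + 1] (EFin \o g).
  apply: continuous_compact_integrable; first exact: segment_compact.
  exact: continuous_subspaceT.
have xx1 : x < x + 1 by rewrite ltrDl.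
have [dG G'] := continuous_FTC1_closed xx1 gint ax (cg x).
by split; [exact: dG|rewrite -derive1E; exact: G'].
Qed.

Lemma has_derivative_within_is_derive (R : realType) (A : set R) (u : R -> R)
    (r d : R) :
  nbhs r A -> has_derivative_within A u r d -> is_derive r 1 u d.
Proof.
move=> rA /cvgrPdist_lt du; apply/is_derive1_caratheodory.
exists (fun z => if z == r then d else (u z - u r) / (z - r)).
split; last by rewrite eqxx.
  move=> z; case: eqVneq => [->|zr]; first by rewrite !subrr mulr0.
  by rewrite divfK// subr_eq0.
apply/cvgrPdist_lt => e e0; rewrite eqxx.
have := du _ e0; rewrite !near_withinE => dux.
near=> z; case: eqVneq => [_|zr]; first by rewrite subrr normr0.
have zA : A z by near: z.
by move: zr zA; near: z.
Unshelve. all: by end_near. Qed.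

Lemma has_derivative_within_continuous (R : realType) (A : set R)
    (u du : R -> R) :
  (forall r, A r -> has_derivative_within A u r (du r)) ->
  {within A, continuous u}.
Proof.
move=> h; apply/subspace_continuousP => r Ar.
have /cvgrPdist_lt/(_ _ ltr01) := h r Ar; rewrite !near_withinE => dux.
apply/cvgrPdist_lt => e e0; rewrite near_withinE.
(* Near [r] the difference quotient is within 1 of [du r], so [|du r| + 1] is a Lipschitz constant
   at [r]. *)
have k0 : 0 < `|du r| + 1 by rewrite ltr_wpDl.
near=> z => Az; have [->|zr] := eqVneq z r; first by rewrite subrr normr0.
have zrk : `|z - r| < e / (`|du r| + 1).
  rewrite distrC; near: z.
  by apply: cvgr_dist_lt; [exact: cvg_id|rewrite divr_gt0].
have : `|du r - (u z - u r) / (z - r)| < 1.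
  by move: zr Az; near: z.
set q := _ / _ => qd.
have -> : u r - u z = - (q * (z - r)) by rewrite divfK ?opprB// subr_eq0.
rewrite normrN normrM; apply: (@le_lt_trans _ _ ((`|du r| + 1) * `|z - r|)).
  rewrite ler_wpM2r// -(subrK (du r) q) addrC (le_trans (ler_normD _ _))//.
  by rewrite lerD2l distrC ltW.
by rewrite mulrC -ltr_pdivlMr.
Unshelve. all: by end_near. Qed.

(* For [H s = s * phi s - \int_0^s phi] with [phi] nondecreasing, the hypothesis
   on [H] stands in for [d H = s d(phi s)], although [phi \o v] may be
   differentiable where [v] is not. *)
Lemma is_derive_legendre (R : realType) (phi H v : R -> R) (r y : R) :
  (forall a b, a * (phi b - phi a) <= H b - H a <= b * (phi b - phi a)) ->
  {for r, continuous v} -> is_derive r 1 (phi \o v) y ->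
  is_derive r 1 (H \o v) (v r * y).
Proof.
move=> Hphi cv /is_derive1_caratheodory[g [gE cg <-]].
(* [xi] is the slope of [H] against [phi] along [v]. By the hypothesis on [H] it lies between [v r]
   and [v z], so it tends to [v r]; multiplied by the Caratheodory slope [g] of [phi \o v] it is a
   Caratheodory slope of [H \o v]. *)
pose xi z := if phi (v z) == phi (v r) then v r
             else (H (v z) - H (v r)) / (phi (v z) - phi (v r)).
have xiE z : H (v z) - H (v r) = xi z * (phi (v z) - phi (v r)).
  rewrite /xi; case: eqVneq => [E|zr]; last by rewrite divfK// subr_eq0.
  have := Hphi (v r) (v z); rewrite E subrr !mulr0 => /andP[? ?].
  by apply/le_anti/andP.
have xi_le z : `|v r - xi z| <= `|v r - v z|.
  rewrite /xi; case: eqVneq => [E|zr]; first by rewrite subrr normr0.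
  have h := Hphi (v r) (v z); rewrite xiE /xi (negbTE zr) in h; move: h.
  set x := _ / _; set p := _ - _.
  have : p != 0 by rewrite subr_eq0.
  rewrite neq_lt => /orP[p0|p0] /andP[].
    rewrite !ler_nM2r// => ? ?; rewrite ger0_norm; last lra.
    by rewrite ger0_norm; lra.
  rewrite !ler_pM2r// => ? ?; rewrite ler0_norm; last lra.
  by rewrite ler0_norm; lra.
have xir : xi r = v r by rewrite /xi eqxx.
apply/is_derive1_caratheodory; exists (xi * g); split.
- by move=> z /=; rewrite xiE [X in _ * X](gE z) mulrA.
- apply: continuousM => //; apply/cvgrPdist_lt => e e0.
  have /cvgrPdist_lt/(_ _ e0) := cv.
  by apply: filterS => z; rewrite xir; exact/le_lt_trans/xi_le.
- by rewrite -xir.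
Qed.

Lemma is_derive_MVT (R : realType) (F f : R -> R) (a b : R) :
  a < b -> (forall x, x \in `[a, b] -> is_derive x 1 F (f x)) ->
  exists2 c, c \in `]a, b[ & F b - F a = f c * (b - a).
Proof.
move=> ab dF.
have dF' x : x \in `]a, b[ -> is_derive x 1 F (f x).
  by move=> xab; apply: dF; exact: subset_itv_oo_cc xab.
have cF : {within `[a, b], continuous F}.
  by apply: derivable_within_continuous => x /dF /@ex_derive.
exact: MVT ab dF' cF.
Qed.

(** * Monotonicity of [varphi] and its Legendre energy *)

Section Varphi.
Context {R : realType} {phi : R -> R}.
Hypothesis phi_ge0 : forall s : R, 0 <= phi s.
Hypothesis phi_cont : continuous phi.
Hypothesis phi_even : forall s : R, phi (- s) = phi s.
Hypothesis phi_incr : {in `]0, +oo[ &, {homo phi : s t / s < t}}.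

Lemma varphi0 : varphi phi 0 = 0.
Proof. by rewrite /varphi mulr0. Qed.

Lemma varphiN s : varphi phi (- s) = - varphi phi s.
Proof. by rewrite /varphi phi_even mulrN. Qed.

Lemma continuous_varphi : continuous (varphi phi).
Proof. by move=> s; apply: continuousM; [exact: phi_cont|exact: cvg_id]. Qed.

Lemma varphi_ge0 s : 0 <= s -> 0 <= varphi phi s.
Proof. by move=> s0; rewrite mulr_ge0. Qed.

Lemma varphi_gt0 s : 0 < s -> 0 < varphi phi s.
Proof.
move=> s0; rewrite mulr_gt0// (le_lt_trans (phi_ge0 (s / 2)))//.
apply: phi_incr; rewrite ?in_itv/= ?andbT ?divr_gt0//.
by rewrite ltr_pdivrMr// ltr_pMr// ltr1n.
Qed.

Lemma varphi_homo : {homo varphi phi : s t / s <= t}.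
Proof.
have H s t : 0 <= s -> s <= t -> varphi phi s <= varphi phi t.
  rewrite le_eqVlt => /predU1P[<- t0|s0 st].
    by rewrite varphi0 varphi_ge0.
  rewrite ler_pM// ?(ltW s0)//.
  move: st; rewrite le_eqVlt => /predU1P[->//|st].
  by rewrite ltW// phi_incr// in_itv/= andbT// (lt_trans s0).
move=> s t st; have [s0|s0] := leP 0 s; first exact: H.
have [t0|t0] := leP 0 t.
  apply: (@le_trans _ _ 0); last exact: varphi_ge0.
  by rewrite -[s]opprK varphiN oppr_le0 varphi_ge0// oppr_ge0 ltW.
rewrite -[s]opprK -[t]opprK !(varphiN (- _)) lerN2; apply: H.
  by rewrite oppr_ge0 ltW.
by rewrite lerN2.
Qed.

(* As [phi] is even, the antiderivative is [P (s ^+ 2)] with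
   [P^`() t = phi (Num.sqrt t) / 2]; this is defined on the whole line although
   [continuous_antiderivative] only works to the right of a base point. *)
Lemma varphi_antiderivative :
  exists Phi : R -> R, forall s : R, is_derive s 1 Phi (varphi phi s).
Proof.
have cpsi : continuous (fun t : R => phi (Num.sqrt t) / 2).
  move=> t; apply: cvgM; last exact: cvg_cst.
  by apply: (@continuous_comp _ _ _ (@Num.sqrt R) phi t);
    [exact: sqrt_continuous|exact: phi_cont].
have [P dP] := continuous_antiderivative (-1) cpsi.
exists (P \o (fun s => s * s)) => s.
have s2 : -1 < s * s by rewrite (lt_le_trans _ (sqr_ge0 s))// ltrN10.
have dss : is_derive s 1 (fun s : R => s * s) (s + s).
  by apply: is_derive_eq; rewrite /GRing.scale/= mulr1.
have := @is_derive1_comp R P (fun s => s * s) s _ _ (dP _ s2) dss.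
move=> h; apply: is_derive_eq; rewrite -expr2 sqrtr_sqr /varphi.
have -> : phi `|s| = phi s by case: (ger0P s) => // _; rewrite phi_even.
by field.
Qed.

(** With [Phi] a primitive of [varphi phi], convex by [varphi_homo], [H] is the Legendre transform
    of [Phi - Phi 0] evaluated at [varphi phi s]. The two bounds are the tangent-line inequalities
    of [Phi] at [b] and at [a]. *)
Lemma varphi_legendre : exists H : R -> R,
  [/\ H 0 = 0, continuous H &
      forall a b, a * (varphi phi b - varphi phi a) <= H b - H a
                    <= b * (varphi phi b - varphi phi a)].
Proof.
have [Phi dPhi] := varphi_antiderivative.
have tangent a b : varphi phi a * (b - a) <= Phi b - Phi a.
  have [ab|ba|->] := ltgtP a b; last by rewrite !subrr mulr0.
    have [c] := is_derive_MVT ab (fun x _ => dPhi x).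
    rewrite in_itv/= => /andP[ac _] ->.
    by rewrite ler_wpM2r ?subr_ge0 ?(ltW ab)// varphi_homo// ltW.
  have [c] := is_derive_MVT ba (fun x _ => dPhi x).
  rewrite in_itv/= => /andP[_ ca] E.
  (* The nested term is a proof of [0 < a - b], transported from [b < a] along [subr_gt0]. *)
  have := ler_wpM2r (ltW (let: h := ba in eq_ind_r is_true h (subr_gt0 _ _)))
    (varphi_homo (ltW ca)).
  lra.
exists (fun s => s * varphi phi s - Phi s + Phi 0); split; first by lra.
  move=> s; apply: cvgD; last exact: cvg_cst.
  apply: cvgB; first by apply: cvgM; [exact: cvg_id|exact: continuous_varphi].
  by apply/differentiable_continuous/derivable1_diffP; have [] := dPhi s.
move=> a b; have := tangent a b; have := tangent b a; lra.
Qed.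

End Varphi.

(** * Sign and antiderivative of the reaction term *)

Section Reaction.
Context {R : realType} {f : R -> R} {u0 : R}.
Hypothesis f_cont : {within `[0, +oo[, continuous f}.
Hypothesis f_nondecr : {in `[0, +oo[ &, {homo f : s t / s <= t}}.
Hypothesis u0_gt0 : 0 < u0.
Hypothesis f_zero : forall s : R, 0 <= s -> (f s = 0 <-> s = u0).

Lemma reaction_le s t : 0 <= s -> s <= t -> f s <= f t.
Proof.
by move=> s0 st; apply: f_nondecr; rewrite // in_itv/= andbT// (le_trans s0).
Qed.

Lemma reaction_lt0 s : 0 <= s -> s < u0 -> f s < 0.
Proof.
move=> s0 su; rewrite lt_neqAle; apply/andP; split.
  by apply/eqP => /(f_zero s0) E; rewrite E ltxx in su.
have <- : f u0 = 0 by apply/f_zero => //; exact: ltW.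
exact/reaction_le/ltW.
Qed.

Lemma reaction_gt0 s : u0 < s -> 0 < f s.
Proof.
move=> us; have s0 := lt_trans u0_gt0 us; rewrite lt_neqAle; apply/andP; split.
  by apply/eqP => /esym/(f_zero (ltW s0)) E; rewrite E ltxx in us.
have <- : f u0 = 0 by apply/f_zero => //; exact: ltW.
by apply: reaction_le; exact: ltW.
Qed.

Lemma reaction_antiderivative : exists F : R -> R,
  F 0 = 0 /\ forall s : R, 0 <= s -> is_derive s 1 F (f s).
Proof.
(* Extending [f] by the constant [f 0] to the left makes the primitive differentiable from both
   sides at 0, the value that [u] takes at [r = 1]. *)
have cf : continuous (fun s : R => f (Num.max 0 s)).
  move=> s; have m0 (t : R) : `[0, +oo[%classic (Num.max 0 t).
    by rewrite /= in_itv/= andbT le_max lexx.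
  have /subspace_continuousP/(_ _ (m0 s))/cvgrPdist_lt fm := f_cont.
  apply/cvgrPdist_lt => e e0.
  have := fm _ e0; rewrite near_withinE => hA.
  have cm : Num.max 0 t @[t --> s] --> Num.max 0 s.
    by apply: (@continuous_max _ _ (cst 0) id s);
      [exact: cvg_cst|exact: cvg_id].
  have hs : \forall t \near s, `[0, +oo[%classic (Num.max 0 t) ->
      `|f (Num.max 0 s) - f (Num.max 0 t)| < e by exact: (cm _ hA).
  by apply: filterS hs => t; apply; exact: m0.
have [F dF] := continuous_antiderivative (-1) cf.
exists (fun s => F s - F 0); split; first by rewrite subrr.
move=> s s0; have s1 : -1 < s by rewrite (lt_le_trans _ s0)// ltrN10.
have := dF _ s1; rewrite (max_idPr s0) => h.
by apply: is_derive_eq; rewrite subr0.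
Qed.

End Reaction.

(** * The convex primitive [F] and the growth of [f] *)

Section Primitive.
Context {R : realType} {f F : R -> R} {u0 : R}.
Hypothesis f_nondecr : {in `[0, +oo[ &, {homo f : s t / s <= t}}.
Hypothesis u0_gt0 : 0 < u0.
Hypothesis f_zero : forall s : R, 0 <= s -> (f s = 0 <-> s = u0).
Hypothesis F0 : F 0 = 0.
Hypothesis dF : forall s : R, 0 <= s -> is_derive s 1 F (f s).

Lemma primitive_MVT a b : 0 <= a -> a < b ->
  exists2 c, c \in `]a, b[ & F b - F a = f c * (b - a).
Proof.
move=> a0 ab; apply: is_derive_MVT ab _ => x.
by rewrite in_itv/= => /andP[ax _]; apply: dF; exact: le_trans ax.
Qed.

Lemma primitive_lt0 s : 0 < s -> s <= u0 -> F s < 0.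
Proof.
move=> s0 su; have [c] := primitive_MVT (lexx 0) s0.
rewrite in_itv/= F0 !subr0 => /andP[c0 cs] ->.
rewrite pmulr_llt0//.
exact: (reaction_lt0 f_nondecr u0_gt0 f_zero (ltW c0) (lt_le_trans cs su)).
Qed.

(** Since [f] is nondecreasing, the mean slope of [F] on [[0, s]] is at most that on [[s, b]]. *)
Lemma primitive_le_chord s b : 0 <= s -> s <= b -> F s * b <= s * F b.
Proof.
rewrite le_eqVlt => /predU1P[<-|s0]; first by rewrite F0 !mul0r.
rewrite le_eqVlt => /predU1P[<-|sb]; first by rewrite mulrC.
have [c] := primitive_MVT (lexx 0) s0.
rewrite in_itv/= F0 !subr0 => /andP[c0 cs] Fs.
have [d] := primitive_MVT (ltW s0) sb; rewrite in_itv/= => /andP[sd db] Fb.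
have fcd : f c <= f d.
  by apply: (reaction_le f_nondecr); [exact: ltW|exact/ltW/(lt_trans cs)].
have : f c * (b - s) <= f d * (b - s) by rewrite ler_wpM2r// subr_ge0 ltW.
by rewrite -Fb Fs => /(ler_wpM2l (ltW s0)); lra.
Qed.

(** Supplies the level separating the two regimes: [F b < 0] feeds the energy bound below it, and
    [u0 < b] keeps [f] positive above it. It exists because [F u0 < 0] and [F] is continuous. *)
Lemma primitive_lt0_past_zero : exists2 b, u0 < b & F b < 0.
Proof.
have Fu0 := primitive_lt0 u0_gt0 (lexx _).
have /differentiable_continuous cF : differentiable F u0.
  by apply/derivable1_diffP; have [] := dF (ltW u0_gt0).
have Flt : \forall z \near u0, F z < 0 by exact: (cvgr_lt _ cF).
have [e /= e0 he] := (nbhs_ballP _ _).1 Flt.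
exists (u0 + e / 2); first by rewrite ltrDl divr_gt0.
apply: he; rewrite /ball/= opprD addNKr normrN gtr0_norm ?divr_gt0//.
by rewrite ltr_pdivrMr// ltr_pMr// ltr1n.
Qed.

(** Past some [M] the limit gives the constant [l / 2]. On the bounded range from [b] up to [m] the
    monotone [f] is at least [f b > 0] while the power is at most its value at [m]. *)
Lemma reaction_ge_powR (b alpha l : R) : u0 < b -> 0 < l -> 0 <= alpha ->
  f s / s `^ alpha @[s --> +oo] --> l ->
  exists2 c, 0 < c & forall s, b <= s -> c * s `^ alpha <= f s.
Proof.
move=> ub l0 a0 /cvgrPdist_lt/(_ (l / 2)).
rewrite divr_gt0// => /(_ isT)[M [_ hM]].
have b0 := lt_trans u0_gt0 ub.
have fb := reaction_gt0 f_nondecr u0_gt0 f_zero ub.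
pose m := Num.max M b.
have m0 : 0 < m by rewrite lt_max b0 orbT.
have ma0 : 0 < m `^ alpha by rewrite powR_gt0.
exists (Num.min (l / 2) (f b / m `^ alpha)).
  by rewrite lt_min !divr_gt0.
move=> s bs; have s0 := lt_le_trans b0 bs.
have sa0 : 0 < s `^ alpha by rewrite powR_gt0.
have [sm|ms] := leP s m.
  have fbs : f b <= f s := reaction_le f_nondecr (ltW b0) bs.
  apply: le_trans fbs.
  apply: (@le_trans _ _ (f b / m `^ alpha * s `^ alpha)).
    by rewrite ler_wpM2r ?(ltW sa0)// ge_min lexx orbT.
  rewrite mulrAC ler_pdivrMr// ler_wpM2l ?(ltW fb)//.
  by rewrite ge0_ler_powR// nnegrE ltW.
have /hM : M < s by rewrite (le_lt_trans _ ms)// le_max lexx.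
rewrite ltr_norml => /andP[_ h].
apply: (@le_trans _ _ (l / 2 * s `^ alpha)).
  by rewrite ler_wpM2r ?(ltW sa0)// ge_min lexx.
by rewrite -ler_pdivlMr//; lra.
Qed.

End Primitive.

(** * Real powers and the differential inequality $-u' \geq k u^q$ *)

Section PowR.
Context {R : realType}.
Implicit Types x y a b c k q M : R.

Lemma powR_root_le x y c q : 0 < c -> 0 < q -> 0 <= x -> 0 <= y ->
  x <= c * y `^ q -> (x / c) `^ q^-1 <= y.
Proof.
move=> c0 q0 x0 y0 xy.
have -> : y = (y `^ q) `^ q^-1 by rewrite -powRrM divff ?gt_eqF// powRr1.
apply: ge0_ler_powR; rewrite ?nnegrE ?invr_ge0 ?powR_ge0//.
- exact: ltW.
- by rewrite divr_ge0// ltW.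
- by rewrite ler_pdivrMr// mulrC.
Qed.

Lemma powR_unbounded k q M : 0 < k -> 0 < q ->
  exists2 x0, 0 < x0 & forall x, x0 < x -> M < (x * k) `^ q.
Proof.
move=> k0 q0; pose m := Num.max M 1.
have m0 : 0 < m by rewrite lt_max ltr01 orbT.
have mq0 : 0 < m `^ q^-1 by rewrite powR_gt0.
exists (m `^ q^-1 / k); first by rewrite divr_gt0.
move=> x; rewrite ltr_pdivrMr// => mx.
apply: (@le_lt_trans _ _ m); first by rewrite le_max lexx.
have -> : m = (m `^ q^-1) `^ q by rewrite -powRrM mulVf ?gt_eqF// powRr1// ltW.
by apply: gt0_ltr_powR => //; rewrite nnegrE ltW// (lt_trans mq0).
Qed.

Lemma powR_comp_MVT (u du : R -> R) a b q : a < b ->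
  (forall r, r \in `[a, b] -> 0 < u r) ->
  (forall r : R, r \in `[a, b] -> is_derive r 1 u (du r)) ->
  exists2 c, c \in `]a, b[ &
    u b `^ (1 - q) - u a `^ (1 - q) =
      (1 - q) * u c `^ (- q) * du c * (b - a).
Proof.
move=> ab u0 Du.
apply: (@is_derive_MVT _ ((fun x => x `^ (1 - q)) \o u)
  (fun c => (1 - q) * u c `^ (- q) * du c) _ _ ab) => x xab.
have := is_derive1_powR (1 - q) (u0 _ xab).
rewrite [X in _ `^ X](_ : _ = - q); last by lra.
by move=> dp; exact: is_derive1_comp dp (Du _ xab).
Qed.

(** The function $u^{1-q}$ has derivative $(1-q)u^{-q}u'$, of absolute value at least $|1-q|k$ when
    [0 <= k]; it decreases for $q<1$ and increases for $q>1$. The nonnegative value at the smaller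
    end is dropped. *)
Lemma powR_decrease_speed (u du : R -> R) a b q k : a < b ->
  (forall r, r \in `[a, b] -> 0 < u r) ->
  (forall r : R, r \in `[a, b] -> is_derive r 1 u (du r)) ->
  (forall r, r \in `[a, b] -> k * u r `^ q <= - du r) ->
  (q < 1 -> (1 - q) * k * (b - a) <= u a `^ (1 - q)) /\
  (1 < q -> (q - 1) * k * (b - a) <= u b `^ (1 - q)).
Proof.
move=> ab u0 Du ku.
have [c /subset_itv_oo_cc cab E] := powR_comp_MVT q ab u0 Du.
have kc : k <= u c `^ (- q) * - du c.
  have := ku _ cab; rewrite powRN -ler_pdivlMr ?powR_gt0 ?u0//.
  by rewrite [in X in _ -> X]mulrC.
have ba : 0 < b - a by rewrite subr_gt0.
have := powR_ge0 (u a) (1 - q); have := powR_ge0 (u b) (1 - q).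
split=> q1; have := ler_wpM2r (ltW ba) kc.
  by move/(ler_wpM2l (_ : 0 <= 1 - q)) => /(_ ltac:(lra)); lra.
by move/(ler_wpM2l (_ : 0 <= q - 1)) => /(_ ltac:(lra)); lra.
Qed.

End PowR.

(** * Composition, minima at an endpoint, integer powers *)

Lemma within_continuous_comp (R : realType) (A : set R) (v G : R -> R) :
  {within A, continuous v} -> (forall x, A x -> {for v x, continuous G}) ->
  {within A, continuous (G \o v)}.
Proof.
move=> /subspace_continuousP cv cG; apply/subspace_continuousP => x Ax.
exact: cvg_comp (cv _ Ax) (cG _ Ax).
Qed.

(** If [d] were positive, the Caratheodory slope would be positive just left of [r], and [u] would
    be smaller there than at [r]. *)
Lemma derivative_le0_at_right_min (R : realType) (u : R -> R) (r d : R) :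
  0 < r -> is_derive r 1 u d -> (forall t, t \in `[0, r] -> u r <= u t) ->
  d <= 0.
Proof.
move=> r0 /is_derive1_caratheodory[g [gE cg <-]] umin.
rewrite leNgt; apply/negP => g0.
have gpos : \forall z \near r, 0 < g z by exact: (cvgr_gt _ cg).
have [e /= e0 he] := (nbhs_ballP _ _).1 gpos.
(* Clipping at 0 keeps [z] in [[0, r]], where [u r] is minimal. *)
pose z := Num.max 0 (r - e / 2).
have zr : z < r by rewrite gt_max r0 ltrBlDr ltrDl divr_gt0.
have z0 : 0 <= z by rewrite le_max lexx.
have gz : 0 < g z.
  apply: he; rewrite /ball/= gtr0_norm ?subr_gt0//.
  have : r - e / 2 <= z by rewrite le_max lexx orbT.
  lra.
have := umin z; rewrite in_itv/= z0 (ltW zr) => /(_ isT).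
by rewrite -subr_ge0 gE pmulr_rge0// subr_ge0 leNgt zr.
Qed.

Lemma within_continuous_exprn (R : realType) (A : set R) (n : nat) :
  {within A, continuous (fun s : R => s ^+ n)}.
Proof. by apply: continuous_subspaceT; exact: exprn_continuous. Qed.

Lemma is_derive_exprn (R : realType) (n : nat) (r : R) :
  is_derive r 1 (fun s : R => s ^+ n) (n%:R * r ^+ n.-1).
Proof.
have -> : (fun s : R => s ^+ n) = (id : R -> R) ^+ n by rewrite exprfctE.
by apply: is_derive_eq; rewrite /GRing.scale/= mulr1.
Qed.

(** * A fixed positive solution: energy, monotonicity, flux *)

Section Solution.
Context {R : realType} {N : nat} {phi f F H : R -> R} {u0 lambda : R}.
Hypothesis hN : (1 < N)%N.
Hypothesis phi_ge0 : forall s : R, 0 <= phi s.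
Hypothesis phi_cont : continuous phi.
Hypothesis phi_even : forall s : R, phi (- s) = phi s.
Hypothesis phi_incr : {in `]0, +oo[ &, {homo phi : s t / s < t}}.
Hypothesis f_nondecr : {in `[0, +oo[ &, {homo f : s t / s <= t}}.
Hypothesis u0_gt0 : 0 < u0.
Hypothesis f_zero : forall s : R, 0 <= s -> (f s = 0 <-> s = u0).
Hypothesis F0 : F 0 = 0.
Hypothesis dF : forall s : R, 0 <= s -> is_derive s 1 F (f s).
Hypothesis H0 : H 0 = 0.
Hypothesis H_cont : continuous H.
Hypothesis H_legendre : forall a b,
  a * (varphi phi b - varphi phi a) <= H b - H a
    <= b * (varphi phi b - varphi phi a).
Hypothesis lambda_gt0 : 0 < lambda.

Context {u du : R -> R}.
Hypothesis u_der : forall r,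
  r \in `[0, 1] -> has_derivative_within `[0, 1] u r (du r).
Hypothesis du_cont : {within `[0, 1], continuous du}.
Hypothesis flux_derivable :
  forall r, r \in `]0, 1[ -> derivable (varphi phi \o du) r 1.
Hypothesis flux_eq : forall r, r \in `]0, 1[ ->
  derive1 (fun s : R => s ^+ N.-1 * varphi phi (du s)) r =
    - (lambda * r ^+ N.-1 * f (u r)).
Hypothesis du0 : du 0 = 0.
Hypothesis u1 : u 1 = 0.
Hypothesis u_pos : forall r, r \in `[0, 1[ -> 0 < u r.

Let W r := r ^+ N.-1 * varphi phi (du r).

Lemma solution_is_derive (r : R) : r \in `]0, 1[ -> is_derive r 1 u (du r).
Proof.
move=> r01; apply: (@has_derivative_within_is_derive _ `[0, 1]%classic).
  by apply: filterS (near_in_itvoo r01) => z; exact: subset_itv_oo_cc.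
exact/u_der/subset_itv_oo_cc.
Qed.

Lemma solution_continuous : {within `[0, 1], continuous u}.
Proof. exact: has_derivative_within_continuous u_der. Qed.

Lemma solution_ge0 r : r \in `[0, 1] -> 0 <= u r.
Proof.
rewrite in_itv/= => /andP[r0]; rewrite le_eqVlt => /predU1P[->|r1].
  by rewrite u1.
by apply/ltW/u_pos; rewrite in_itv/= r0.
Qed.

Lemma flux_is_derive (r : R) : r \in `]0, 1[ ->
  is_derive r 1 W (- (lambda * r ^+ N.-1 * f (u r))).
Proof.
move=> r01; rewrite -flux_eq// derive1E; apply: derivableP.
apply: derivableM; last exact: flux_derivable.
exact: (@ex_derive _ _ _ _ _ _ _ (is_derive_exprn N.-1 r)).
Qed.

(** The equation in nondivergence form, $y + \frac{N-1}{r}\varphi(u') = -\lambda f(u)$, multiplied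
    by $r$. It results from the product rule for the flux after cancelling $r^{N-2}$, which makes
    sense since [1 < N]. *)
Lemma varphi_du_is_derive (r : R) : r \in `]0, 1[ ->
  exists2 y : R, is_derive r 1 (varphi phi \o du) y &
    r * (y + lambda * f (u r)) = - (N.-1%:R * varphi phi (du r)).
Proof.
move=> r01; have dy := derivableP (flux_derivable r01).
move: dy; set y := derive _ _ _ => dy; exists y; first exact: dy.
have rn := is_derive_exprn N.-1 r.
have := is_deriveM rn dy; have := flux_is_derive r01.
move=> /@derive_val E1 /@derive_val E2.
have r0 : 0 < r by move: r01; rewrite in_itv/= => /andP[].
have rn0 : 0 < r ^+ N.-2 by rewrite exprn_gt0.
move: E2; rewrite [LHS]E1 /GRing.scale/=.
have -> : r ^+ N.-1 = r * r ^+ N.-2.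
  by rewrite -exprS prednK// -ltnS prednK// ltnW.
move=> E; apply: (mulfI (lt0r_neq0 rn0)); lra.
Qed.

Lemma energy_ge0 r : r \in `[0, 1] -> 0 <= lambda * F (u r) + H (du r).
Proof.
pose E := fun r => lambda * (F \o u) r + (H \o du) r.
have dE (x : R) : x \in `]0, 1[ -> exists2 d : R, is_derive x 1 E d & d <= 0.
  move=> x01; have [y dy Ey] := varphi_du_is_derive x01.
  have dux : {for x, continuous du}.
    exact: within_continuous_continuous ltr01 du_cont x01.
  have dHx := is_derive_legendre H_legendre dux dy.
  have ux := solution_ge0 (subset_itv_oo_cc x01).
  have dFx := is_derive1_comp (dF ux) (solution_is_derive x01).
  exists (lambda * (f (u x) * du x) + du x * y).
    by apply: is_derive_eq.
  have x0 : 0 < x by move: x01; rewrite in_itv/= => /andP[].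
  (* Multiplied by [x], the derivative of the energy becomes $-(N-1)u'\varphi(u')$, and
     $u'\varphi(u') = \phi(u')u'^2 \geq 0$. *)
  rewrite -(pmulr_rle0 _ x0).
  have -> : x * (lambda * (f (u x) * du x) + du x * y) =
      du x * (x * (y + lambda * f (u x))) by ring.
  rewrite Ey mulrN oppr_le0 mulrCA mulr_ge0// /varphi mulrCA mulr_ge0//.
  exact: sqr_ge0.
have cE : {within `[0, 1], continuous E}.
  have cF : {within `[0, 1], continuous (F \o u)}.
    apply: (within_continuous_comp solution_continuous) => x x01.
    apply/differentiable_continuous/derivable1_diffP.
    by have [] := dF (solution_ge0 x01).
  have cHdu : {within `[0, 1], continuous (H \o du)}.
    by apply: (within_continuous_comp du_cont) => x _; exact: H_cont.
  move=> x; apply: cvgD; last exact: cHdu.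
  by apply: cvgM; [exact: cvg_cst|exact: cF].
move=> r01.
(* At [r = 1] only [H (du 1)] remains, which is nonnegative by [H_legendre] with [a = 0]. *)
have E1 : 0 <= E 1.
  rewrite /E/= u1 F0 mulr0 add0r.
  have := H_legendre 0 (du 1); rewrite H0 subr0 mul0r => /andP[]//.
apply: (le_trans E1).
have := @ler0_derive1_le_cc R E 0 1 _ _ cE; apply => //.
- by move=> x /dE[d [? _] _].
- by move=> x /dE[d dxE d0]; rewrite derive1E (@derive_val _ _ _ _ _ _ _ dxE).
- by rewrite in_itv/= lexx ler01.
- by move: r01; rewrite in_itv/= => /andP[].
Qed.

Lemma critical_point_gt r : r \in `[0, 1[ -> du r = 0 -> u0 < u r.
Proof.
move=> r01 dur; rewrite ltNge; apply/negP => ru.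
have := energy_ge0 (subset_itv_co_cc r01); rewrite dur H0 addr0 pmulr_rge0//.
by rewrite leNgt (primitive_lt0 f_nondecr u0_gt0 f_zero F0 dF)// u_pos.
Qed.

Lemma flux_continuous : {within `[0, 1], continuous W}.
Proof.
have cY : {within `[0, 1], continuous (varphi phi \o du)}.
  apply: (within_continuous_comp du_cont) => x _.
  exact: continuous_varphi.
by move=> x; apply: cvgM; [exact: within_continuous_exprn|exact: cY].
Qed.

Lemma flux0 : W 0 = 0.
Proof. by rewrite /W du0 varphi0 mulr0. Qed.

Lemma subset_itv01 (r : R) : r < 1 -> `[0, r] `<=` `[0, 1]%classic.
Proof.
by move=> r1 x /=; rewrite !in_itv/= => /andP[-> /le_trans->]//; exact: ltW.
Qed.

(* If [du r > 0], then [u] has a minimum over [[0, r]] at a critical point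
   before [r], so [u0 < u] on [[0, r]] and the flux [W] can only decrease from
   [W 0 = 0], which contradicts [W r > 0]. *)
Lemma solution_du_le0 r : r \in `]0, 1[ -> du r <= 0.
Proof.
move=> r01; rewrite leNgt; apply/negP => dur.
have [r0 r1] : 0 < r /\ r < 1 by move: r01; rewrite in_itv/= => /andP.
have sub := subset_itv01 r1.
have cu := continuous_subspaceW sub solution_continuous.
have [m mr umin] := EVT_min (ltW r0) cu.
have [m0 mler] : 0 <= m /\ m <= r by move: mr; rewrite in_itv/= => /andP.
have mltr : m < r.
  rewrite lt_neqAle mler andbT; apply/eqP => Em; rewrite Em in umin.
  have := derivative_le0_at_right_min r0 (solution_is_derive r01) umin.
  by rewrite leNgt dur.
have dum : du m = 0.
  (* A minimum at 0 is critical by the condition [du 0 = 0], an interior one by Fermat's rule. *)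
  move: m0; rewrite le_eqVlt => /predU1P[<-//|m0].
  have m01 : m \in `]0, 1[ by rewrite in_itv/= m0 (lt_trans mltr).
  have sub' t : t \in `]0, r[ -> t \in `]0, 1[.
    by rewrite !in_itv/= => /andP[-> /lt_trans->].
  have dr t : t \in `]0, r[ -> derivable u t 1.
    by move=> /sub'/solution_is_derive[].
  have m0r : m \in `]0, r[ by rewrite in_itv/= m0.
  have /@derive_val := derive1_at_min (ltW r0) dr m0r
    (fun t ht => umin t (subset_itv_oo_cc ht)).
  by have /@derive_val -> := solution_is_derive m01.
have um : u0 < u m.
  by apply: critical_point_gt; rewrite // in_itv/= m0 (lt_trans mltr).
have dW (x : R) : x \in `]0, r[ ->
    is_derive x 1 W (- (lambda * x ^+ N.-1 * f (u x))).
  rewrite in_itv/= => /andP[x0 xr]; apply: flux_is_derive.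
  by rewrite in_itv/= x0 (lt_trans xr).
have cW := continuous_subspaceW sub flux_continuous.
have [c] := MVT r0 dW cW; rewrite flux0 !subr0 => cr WE.
have : W r <= 0.
  rewrite WE mulNr oppr_le0 mulr_ge0 ?(ltW r0)//.
  have [c0 _] : 0 < c /\ c < r by move: cr; rewrite in_itv/= => /andP.
  rewrite mulr_ge0// ?mulr_ge0 ?(ltW lambda_gt0) ?exprn_ge0 ?(ltW c0)//.
  apply/ltW/(reaction_gt0 f_nondecr u0_gt0 f_zero)/(lt_le_trans um)/umin.
  exact: subset_itv_oo_cc.
rewrite leNgt mulr_gt0 ?exprn_gt0//.
exact: varphi_gt0.
Qed.

Lemma solution_noninc r s : 0 <= r -> r <= s -> s < 1 -> u s <= u r.
Proof.
move=> r0 rs s1.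
have := @ler0_derive1_le_cc R u 0 s _ _
  (continuous_subspaceW (subset_itv01 s1) solution_continuous).
have sub' t : t \in `]0, s[ -> t \in `]0, 1[.
  by rewrite !in_itv/= => /andP[-> /lt_trans->].
apply => //.
- by move=> x /sub'/solution_is_derive[].
- move=> x /sub' x01; rewrite derive1E.
  by have /@derive_val -> := solution_is_derive x01; exact: solution_du_le0.
- by rewrite in_itv/= (le_trans r0 rs) lexx.
- by rewrite in_itv/= r0.
Qed.

(** As [u] is nonincreasing, $f(u(x)) \geq f(u(r))$ for $x \leq r$; integrating the equation over
    [[0, r]] with this bound and dividing by $r^{N-1}$ gives the estimate. *)
Lemma flux_le r : r \in `]0, 1[ ->
  lambda * f (u r) * (r / N%:R) <= varphi phi (- du r).
Proof.
move=> r01.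
have [r0 r1] : 0 < r /\ r < 1 by move: r01; rewrite in_itv/= => /andP.
have N0 : (0 : R) < N%:R by rewrite ltr0n ltnW.
have NS : N = N.-1.+1 by rewrite prednK// ltnW.
pose k := lambda * f (u r) / N%:R.
(* The integration is done by the mean value theorem: [k * s ^+ N] is the flux lost if the reaction
   were frozen at [f (u r)], so [V] starts at 0 and has nonpositive derivative. *)
pose V s := W s + k * s ^+ N.
have dV (x : R) : x \in `]0, r[ ->
    is_derive x 1 V (lambda * x ^+ N.-1 * (f (u r) - f (u x))).
  rewrite in_itv/= => /andP[x0 xr].
  have x01 : x \in `]0, 1[ by rewrite in_itv/= x0 (lt_trans xr).
  have dWx := flux_is_derive x01.
  have dx := is_derive_exprn N x.
  apply: is_derive_eq; rewrite /GRing.scale/= /k.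
  by field; rewrite gt_eqF.
have cV : {within `[0, r], continuous V}.
  move=> x; apply: cvgD.
    exact: (continuous_subspaceW (subset_itv01 r1) flux_continuous).
  apply: cvgM; first exact: cvg_cst.
  exact: within_continuous_exprn.
have [c] := MVT r0 dV cV; rewrite in_itv/= => /andP[c0 cr].
rewrite /V flux0 {2}NS expr0n/= mulr0 addr0 !subr0 => E.
have : W r + k * r ^+ N <= 0.
  rewrite E pmulr_lle0// mulr_ge0_le0 ?mulr_ge0 ?(ltW lambda_gt0)//.
    by rewrite exprn_ge0// ltW.
  rewrite subr_le0; apply: (reaction_le f_nondecr).
    by apply: solution_ge0; rewrite in_itv/= !ltW.
  by apply: solution_noninc => //; exact: ltW.
have -> : W r + k * r ^+ N = r ^+ N.-1 * (varphi phi (du r) + k * r).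
  have -> : r ^+ N = r * r ^+ N.-1 by rewrite {1}NS exprS.
  by rewrite /W; ring.
rewrite pmulr_rle0 ?exprn_gt0// varphiN//.
have -> : lambda * f (u r) * (r / N%:R) = k * r by rewrite /k; ring.
lra.
Qed.

(** * Transit estimates below and above the level [b] *)

Context {p c1 b : R}.
Hypothesis p_gt1 : 1 < p.
Hypothesis c1_gt0 : 0 < c1.
Hypothesis varphi_le : forall s, 0 <= s -> varphi phi s <= c1 * s `^ (p - 1).
Hypothesis b_gt : u0 < b.

(** Energy, $H(s) \leq s\varphi(s)$ and the upper bound on $\varphi$ give $-\lambda F(u) \leq
    c_1|u'|^p$. The chord bound on $F$ turns this into $-u' \geq k u^q$ with $q = 1/p < 1$ on
    [[1/2, 3/4]], where [u] is still positive. *)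
Lemma solution_transit_below : u 2^-1 <= b -> F b < 0 ->
  (1 - p^-1) * (lambda * (- F b / b / c1)) `^ p^-1 * (3 / 4 - 2^-1)
    <= b `^ (1 - p^-1).
Proof.
move=> ub Fb; have b0 := lt_trans u0_gt0 b_gt.
have p0 : 0 < p := lt_trans ltr01 p_gt1.
have ip1 : p^-1 < 1 by rewrite invf_lt1.
have k0 : 0 < - F b / b / c1 by rewrite !divr_gt0// oppr_gt0.
have sub01 (r : R) : r \in `[2^-1, 3 / 4] -> r \in `]0, 1[.
  by rewrite !in_itv/= => /andP[? ?]; apply/andP; split; lra.
have u_gt0 (r : R) : r \in `[2^-1, 3 / 4] -> 0 < u r.
  by move=> /sub01/subset_itv_oo_co; exact: u_pos.
have half : 2^-1 < 3 / 4 :> R by lra.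
have speed (r : R) : r \in `[2^-1, 3 / 4] ->
    (lambda * (- F b / b / c1)) `^ p^-1 * u r `^ p^-1 <= - du r.
  move=> r01; have ur := u_gt0 _ r01.
  have dur := solution_du_le0 (sub01 _ r01).
  have urb : u r <= b.
    apply: le_trans ub; move: r01; rewrite in_itv/= => /andP[? ?].
    by apply: solution_noninc; lra.
  have lk0 : 0 <= lambda * (- F b / b).
    by apply/ltW; rewrite mulr_gt0// divr_gt0// oppr_gt0.
  have -> : lambda * (- F b / b / c1) = lambda * (- F b / b) / c1 by ring.
  rewrite -powRM ?(ltW ur)//; last by rewrite divr_ge0// ltW.
  rewrite mulrAC; apply: powR_root_le => //.
  - by rewrite mulr_ge0// ltW.
  - by rewrite oppr_ge0.
  have Fu : F (u r) <= F b / b * u r.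
    rewrite mulrAC ler_pdivlMr// [X in _ <= X]mulrC.
    exact: (primitive_le_chord f_nondecr F0 dF (ltW ur) urb).
  have := ler_wpM2l (ltW lambda_gt0) Fu.
  have := energy_ge0 (subset_itv_oo_cc (sub01 _ r01)).
  have := H_legendre 0 (du r); rewrite H0 varphi0 !subr0 mul0r => /andP[_].
  have e0 : 0 <= - du r by rewrite oppr_ge0.
  have := ler_wpM2l e0 (varphi_le e0); rewrite varphiN// mulrCA mulr_powRB1//.
  lra.
have [+ _] := powR_decrease_speed half u_gt0
  (fun r hr => solution_is_derive (sub01 r hr)) speed.
move=> /(_ ip1) /le_trans; apply; apply: ge0_ler_powR => //.
- by rewrite subr_ge0 ltW.
- by rewrite nnegrE ltW// u_gt0// in_itv/= lexx ltW.
- by rewrite nnegrE ltW.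
Qed.

(** For $r \geq 1/4$ the flux estimate and the growth of $f$ give $\lambda c u^\alpha/(4N) \leq
    c_1|u'|^{p-1}$, that is $-u' \geq k u^q$ with $q = \alpha/(p-1) > 1$ on [[1/4, 1/2]]. *)
Lemma solution_transit_above (alpha c : R) : p - 1 < alpha -> 0 < c ->
  (forall s, b <= s -> c * s `^ alpha <= f s) -> b <= u 2^-1 ->
  (alpha / (p - 1) - 1) * (lambda * (c / (4 * N%:R) / c1)) `^ (p - 1)^-1
    * (2^-1 - 4^-1) <= b `^ (1 - alpha / (p - 1)).
Proof.
move=> pa c0 fc bu; have b0 := lt_trans u0_gt0 b_gt.
have p0 : 0 < p - 1 by rewrite subr_gt0.
have N0 : (0 : R) < N%:R by rewrite ltr0n ltnW.
have q1 : 1 < alpha / (p - 1) by rewrite ltr_pdivlMr// mul1r.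
have k0 : 0 < c / (4 * N%:R) by rewrite divr_gt0// mulr_gt0.
have sub01 (r : R) : r \in `[4^-1, 2^-1] -> r \in `]0, 1[.
  by rewrite !in_itv/= => /andP[? ?]; apply/andP; split; lra.
have u_gt0 (r : R) : r \in `[4^-1, 2^-1] -> 0 < u r.
  by move=> /sub01/subset_itv_oo_co; exact: u_pos.
have half : 4^-1 < 2^-1 :> R by lra.
have speed (r : R) : r \in `[4^-1, 2^-1] ->
    (lambda * (c / (4 * N%:R) / c1)) `^ (p - 1)^-1 * u r `^ (alpha / (p - 1))
    <= - du r.
  move=> r01; have ur := u_gt0 _ r01.
  have dur := solution_du_le0 (sub01 _ r01).
  have [r4 r2] : 4^-1 <= r /\ r <= 2^-1 by move: r01; rewrite in_itv/= => /andP.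
  have bur : b <= u r by apply: (le_trans bu); apply: solution_noninc; lra.
  have e0 : 0 <= - du r by rewrite oppr_ge0.
  have ua0 := powR_ge0 (u r) alpha.
  have lk0 : 0 <= lambda * (c / (4 * N%:R)) by rewrite mulr_ge0 ?ltW.
  rewrite powRrM mulrA -powRM//; last by rewrite divr_ge0// ltW.
  rewrite mulrAC; apply: powR_root_le => //; first exact: mulr_ge0.
  apply: le_trans (varphi_le e0); apply: le_trans (flux_le (sub01 _ r01)).
  have -> : lambda * (c / (4 * N%:R)) * u r `^ alpha =
      lambda * (c * u r `^ alpha) * (4^-1 / N%:R) by field; rewrite gt_eqF.
  apply: ler_pM.
  - by rewrite mulr_ge0 ?mulr_ge0// ltW.
  - by rewrite ltW// divr_gt0// invr_gt0.
  - by rewrite ler_wpM2l ?(ltW lambda_gt0)// fc.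
  - by rewrite ler_wpM2r// invr_ge0 ltW.
have [_] := powR_decrease_speed half u_gt0
  (fun r hr => solution_is_derive (sub01 r hr)) speed.
move=> /(_ q1) /le_trans; apply.
(* The exponent is negative, so [b <= u 2^-1] reverses when the power is taken. *)
have -> : 1 - alpha / (p - 1) = - (alpha / (p - 1) - 1) by ring.
rewrite !powRN lef_pV2 ?posrE ?powR_gt0// ?(lt_le_trans b0)//.
apply: ge0_ler_powR => //; first by rewrite subr_ge0 ltW.
- by rewrite nnegrE ltW.
- by rewrite nnegrE ltW// (lt_le_trans b0).
Qed.

End Solution.

(** * Choice of the threshold and conclusion *)

Theorem theorem1 (R : realType) (N : nat) (hN : (1 < N)%N)
  (f : R -> R)
  (f_cont : {within `[0, +oo[, continuous f})
  (f_nondecr : {in `[0, +oo[ &, {homo f : s t / s <= t}})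
  (f0_lt0 : f 0 < 0)
  (u0 : R) (u0_gt0 : 0 < u0)
  (f_zero : forall s : R, 0 <= s -> (f s = 0 <-> s = u0))
  (p : R) (hp : 1 < p)
  (alpha : R) (halpha_lb : p - 1 < alpha)
  (halpha_ub : (alpha%:E < critical_exponent N p)%E)
  (l : R) (hl : 0 < l)
  (f_lim : f s / s `^ alpha @[s --> +oo] --> l)
  (phi : R -> R)
  (phi_ge0 : forall s : R, 0 <= phi s)
  (phi_cont : continuous phi)
  (phi_diff : forall s : R, s != 0 -> derivable phi s 1)
  (phi_even : forall s : R, phi (- s) = phi s)
  (phi_incr : {in `]0, +oo[ &, {homo phi : s t / s < t}})
  (c1 c2 : R) (hc1 : 0 < c1) (hc2 : 0 < c2)
  (phi_bounds : forall r : R, 0 <= r ->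
     c2 * r `^ (p - 1) <= varphi phi r <= c1 * r `^ (p - 1)) :
  exists lambda0 : R, 0 < lambda0 /\
    forall lambda : R, lambda0 < lambda ->
      ~ exists u : R -> R, positive_radial_solution N phi f lambda u.
Proof.
have [F [F0 dF]] := reaction_antiderivative f_cont.
have [H [H0 H_cont H_legendre]] :=
  varphi_legendre phi_ge0 phi_cont phi_even phi_incr.
have [b ub Fb] := primitive_lt0_past_zero f_nondecr u0_gt0 f_zero F0 dF.
have b0 := lt_trans u0_gt0 ub.
have alpha0 : 0 <= alpha by lra.
have [c c0 fc] := reaction_ge_powR f_nondecr u0_gt0 f_zero ub hl alpha0 f_lim.
have N0 : (0 : R) < N%:R by rewrite ltr0n ltnW.
have p0 : 0 < p by lra.
have p1 : 0 < p - 1 by lra.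
have s0 : 0 < 1 - p^-1 by rewrite subr_gt0 invf_lt1.
have t0 : 0 < alpha / (p - 1) - 1 by rewrite subr_gt0 ltr_pdivlMr// mul1r.
have k0 : 0 < - F b / b / c1 by rewrite !divr_gt0// oppr_gt0.
have j0 : 0 < c / (4 * N%:R) / c1 by rewrite !divr_gt0// mulr_gt0.
have ip0 : 0 < p^-1 by rewrite invr_gt0.
have iq0 : 0 < (p - 1)^-1 by rewrite invr_gt0.
(* Both transit intervals have length 1/4, whence the factor 4; beyond [x] and [y] the respective
   transit estimates fail. *)
have [x x0 hx] := powR_unbounded (4 * b `^ (1 - p^-1) / (1 - p^-1)) k0 ip0.
have [y y0 hy] := powR_unbounded
  (4 * b `^ (1 - alpha / (p - 1)) / (alpha / (p - 1) - 1)) j0 iq0.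
exists (Num.max x y); split; first by rewrite lt_max x0.
move=> lambda; rewrite gt_max => /andP[/[dup] xl /hx {}hx /hy {}hy].
have lambda0 := lt_trans x0 xl.
move=> [u [[du [[u_der du_cont] [flux_derivable _] flux_eq du0 u1]] u_pos]].
have varphi_le s : 0 <= s -> varphi phi s <= c1 * s `^ (p - 1).
  by move=> /phi_bounds/andP[].
(* By monotonicity the value at 1/2 decides whether [u] stays below [b] to the right of 1/2 or above
   [b] to its left. *)
have [ub2|/ltW ub2] := leP (u 2^-1) b.
  have := solution_transit_below hN phi_ge0 phi_cont phi_even phi_incr f_nondecr
    u0_gt0 f_zero F0 dF H0 H_cont H_legendre lambda0 u_der du_cont
    flux_derivable flux_eq du0 u1 u_pos hp hc1 varphi_le ub ub2 Fb.
  by move: hx; rewrite ltr_pdivrMr//; lra.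
have := solution_transit_above hN phi_ge0 phi_cont phi_even phi_incr f_nondecr
  u0_gt0 f_zero F0 dF H0 H_cont H_legendre lambda0 u_der du_cont
  flux_derivable flux_eq du0 u1 u_pos hp hc1 varphi_le ub halpha_lb c0 fc ub2.
by move: hy; rewrite ltr_pdivrMr//; lra.
Qed.
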